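(* Let $q \geq 8$ be an even prime power (a power of $2$) and let $\mathbb{F}_q$ be the finite field with $q$ elements. Let $k$ and $m$ be integers with $k \geq q/2$ and $1 \leq m \leq q/2$, and let $h(x_1,\dots,x_k) \in \mathbb{F}_q[x_1,\dots,x_k]$ be a complete symmetric polynomial of degree $m$ in $k$ variables over $\mathbb{F}_q$. Then $$N_q(h) \geq \left(\frac{q}{2}\right)! \cdot q^{\,k - \frac{q}{2}}.$$
   Context: For $e \geq 0$, the homogeneous complete symmetric polynomial of degree $e$ in the variables $x_1,\dots,x_k$ is $$h_e(x_1,\dots,x_k) = \sum_{1 \leq i_1 \leq i_2 \leq \cdots \leq i_e \leq k} x_{i_1} x_{i_2} \cdots x_{i_e},$$ with $h_0 = 1$. A complete symmetric polynomial of degree $m$ over $\mathbb{F}_q$ in the variables $x_1,\dots,x_k$ is a polynomial of the form $h(x_1,\dots,x_k) = \sum_{e=0}^m a_e h_e(x_1,\dots,x_k)$ with $a_e \in \mathbb{F}_q$ and $a_m \neq 0$ (not homogeneous in general). For such $h$, $$N_q(h) = \#\{(x_1,\dots,x_k) \in \mathbb{F}_q^k \mid h(x_1,\dots,x_k) = 0\}.$$ *)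

(* Defs.v *)
From mathcomp Require Import all_boot all_algebra.
From mathcomp Require Import mpoly.

Set Implicit Arguments.
Unset Strict Implicit.
Unset Printing Implicit Defensive.

Local Open Scope ring_scope.

(* h_e(x_1,...,x_k): the tuples t are the sequences
   i_1 <= i_2 <= ... <= i_e of indices; for e = 0 only the empty one, so
   h_0 = 1. *)
Definition hcsym (k : nat) (R : comNzRingType) (e : nat) : {mpoly R[k]} :=
  \sum_(t : e.-tuple 'I_k | sorted leq (map val t)) \prod_(i <- t) 'X_i.

Definition is_csym (k : nat) (R : comNzRingType) (m : nat)
    (h : {mpoly R[k]}) : Prop :=
  exists a : nat -> R,
    a m != 0 /\ h = \sum_(e < m.+1) a e *: hcsym k R e.

Definition zero_count (k : nat) (F : finFieldType) (h : {mpoly F[k]}) : nat :=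
  #|[set x : {ffun 'I_k -> F} | h.@[x] == 0]|.

(* Main.v *)
(* With n = q/2, fixing k - n coordinates of h leaves a complete symmetric
   polynomial of the same degree m in n variables, so it suffices to find one
   zero with n distinct coordinates and permute it.  For an n-subset S of F with
   complement T, X^q - X = prod_S (X - s) * prod_T (X - t) shows that h_e(S) is the
   coefficient of X^(n-e) in prod_T (X - t), so we want an n-set T at which the
   linear functional L : X^i |-> a_(n-i) kills prod_T (X - t).
   Suppose there is none.  For an (n-2)-set V with product g, the pairs {s,t} with
   L(g (X-s)(X-t)) = 0 form an involution of the projective line; counting its
   values outside V shows that it is degenerate or the identity.  Varying one more
   point makes the moments L(g), L(gX), L(gX^2), L(gX^3) rank one for every
   (n-3)-set, and removing the points one at a time makes the whole sequence
   L(X^i) rank one.  Then L is evaluation at some rho (or its leading moment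
   vanishes, which contradicts m >= 1), and any T containing rho works. *)
Require Import Defs.
From mathcomp Require Import all_boot all_algebra all_field.
From mathcomp Require Import mpoly ring zify.

Set Implicit Arguments.
Unset Strict Implicit.
Unset Printing Implicit Defensive.

Import GRing.Theory.
Local Open Scope ring_scope.

(** * Moment sequences and rank-one Hankel conditions *)

Lemma card_setC_seq (T : finType) (s : seq T) :
  (#|T| <= size s + #|~: [set x in s]|)%N.
Proof. by rewrite -(cardsC [set x in s]) leq_add2r cardsE card_size. Qed.

(** With [b i] read as L(X^i), these are the moments of p |-> L((X - r) p), so [shift s b 0] is L at
    the product of the X - r for [r] in [s]. *)
Definition shift1 (R : nzRingType) (r : R) (b : nat -> R) (i : nat) : R :=
  b i.+1 - r * b i.

Definition shift (R : nzRingType) (s : seq R) (b : nat -> R) : nat -> R :=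
  foldl (fun c r => shift1 r c) b s.

(** Vanishing of the 2x2 minors of the 2 by [d] Hankel matrix on [b 0, ..., b d]. *)
Definition hankel_rank1 (R : nzRingType) (d : nat) (b : nat -> R) : Prop :=
  forall i j, (i < d)%N -> (j < d)%N -> b i * b j.+1 = b i.+1 * b j.

Lemma hankel_rank1_2 (R : comNzRingType) (b : nat -> R) :
  b 1%N ^+ 2 = b 0%N * b 2%N -> hankel_rank1 2 b.
Proof.
move=> b_eq [|[|//]] [|[|//]] _ _; rewrite ?(mulrC (b 1%N)) ?(mulrC (b 2%N)) //.
all: by rewrite -b_eq.
Qed.

Lemma quadratic_three_roots (R : idomainType) (p0 p1 p2 x y z : R) :
    x != y -> y != z -> z != x ->
    p0 + x * p1 + x ^+ 2 * p2 = 0 -> p0 + y * p1 + y ^+ 2 * p2 = 0 ->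
    p0 + z * p1 + z ^+ 2 * p2 = 0 ->
  [/\ p0 = 0, p1 = 0 & p2 = 0].
Proof.
move=> xy yz zx px py pz.
have dxy : x - y != 0 by rewrite subr_eq0.
have dyz : y - z != 0 by rewrite subr_eq0.
have dzx : z - x != 0 by rewrite subr_eq0.
have qxy : p1 + (x + y) * p2 = 0.
  apply: (mulfI dxy); rewrite mulr0.
  transitivity ((p0 + x * p1 + x ^+ 2 * p2) - (p0 + y * p1 + y ^+ 2 * p2)).
    by ring.
  by rewrite px py subr0.
have qyz : p1 + (y + z) * p2 = 0.
  apply: (mulfI dyz); rewrite mulr0.
  transitivity ((p0 + y * p1 + y ^+ 2 * p2) - (p0 + z * p1 + z ^+ 2 * p2)).
    by ring.
  by rewrite py pz subr0.
have p2_0 : p2 = 0.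
  apply: (mulfI dzx); rewrite mulr0.
  transitivity ((p1 + (y + z) * p2) - (p1 + (x + y) * p2)); first by ring.
  by rewrite qxy qyz subr0.
have p1_0 : p1 = 0 by rewrite p2_0 mulr0 addr0 in qxy.
by rewrite p2_0 p1_0 !mulr0 !addr0 in px.
Qed.

(** Each minor of [shift1 r b] is a quadratic in [r] with minors of [b] as coefficients, up to sign,
    so three distinct roots kill them all. *)
Lemma hankel_rank1_lift (R : idomainType) (d : nat) (b : nat -> R) (x y z : R) :
    (1 < d)%N -> x != y -> y != z -> z != x ->
    hankel_rank1 d (shift1 x b) -> hankel_rank1 d (shift1 y b) ->
    hankel_rank1 d (shift1 z b) ->
  hankel_rank1 d.+1 b.
Proof.
move=> d_gt1 xy yz zx bx b_y bz.
have minors i j : (i < d)%N -> (j < d)%N ->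
    [/\ b i * b j.+1 = b i.+1 * b j, b i * b j.+2 = b i.+2 * b j
      & b i.+1 * b j.+2 = b i.+2 * b j.+1].
  move=> lt_i lt_j.
  pose p0 := b i.+1 * b j.+2 - b i.+2 * b j.+1.
  pose p1 := b i.+2 * b j - b i * b j.+2.
  pose p2 := b i * b j.+1 - b i.+1 * b j.
  have root r : hankel_rank1 d (shift1 r b) -> p0 + r * p1 + r ^+ 2 * p2 = 0.
    move=> /(_ i j lt_i lt_j)/eqP; rewrite -subr_eq0 => /eqP <-.
    by rewrite /p0 /p1 /p2 /shift1; ring.
  have [/eqP + /eqP + /eqP] := quadratic_three_roots xy yz zx
    (root _ bx) (root _ b_y) (root _ bz).
  rewrite !subr_eq0 => /eqP e0 /eqP e1 /eqP e2; by split.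
have ordered i j : (i < j)%N -> (j < d.+1)%N -> b i * b j.+1 = b i.+1 * b j.
  move=> lt_ij; rewrite ltnS leq_eqVlt => /orP[/eqP ej|lt_j]; last first.
    by have [] := minors i j (ltn_trans lt_ij lt_j) lt_j.
  case: j lt_ij ej => // j; rewrite ltnS; case: i => [|i] lt_ij ej.
    case: j lt_ij ej => [|j] _ ej; first by rewrite -ej in d_gt1.
    (* The corner minor, on columns 0 and [d], takes two instances: [b 0 * b (d+1)] and [b 1 * b d]
       both equal [b 2 * b (d-1)]. *)
    have [_ -> _] : [/\ b 0%N * b j.+2 = b 1%N * b j.+1,
        b 0%N * b j.+3 = b 2%N * b j.+1 & b 1%N * b j.+3 = b 2%N * b j.+2].
      by apply: minors; lia.
    by have [] := minors 1%N j.+1 d_gt1 ltac:(lia).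
  by have [] : [/\ b i * b j.+1 = b i.+1 * b j, b i * b j.+2 = b i.+2 * b j
      & b i.+1 * b j.+2 = b i.+2 * b j.+1] by apply: minors; lia.
move=> i j lt_i lt_j; case: (ltngtP i j) => [lt_ij|lt_ji|->]; last exact: mulrC.
  exact: ordered.
by rewrite mulrC -ordered // mulrC.
Qed.

(* When c_1^2 <> c_0 c_2, the zeros (s, t) of the form below make up the graph of
   a Moebius involution of the projective line; in characteristic 2 it has at
   most one fixed point unless it is the identity, i.e. c_0 = c_2 = 0. *)
Lemma hankel_pair (F : finFieldType) (W : seq F) (c : nat -> F) :
    2%N \in [pchar F] -> (2 * (size W + 2) <= #|F|)%N -> uniq W ->
    (forall V, uniq (V ++ W) -> size V = 2%N -> shift V c 0%N != 0) ->
  c 1%N ^+ 2 = c 0%N * c 2%N \/ c 0%N = 0 /\ c 2%N = 0.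
Proof.
move=> F2 card_F W_uniq nz.
have [->|nondeg] := eqVneq (c 1%N ^+ 2) (c 0%N * c 2%N); first by left.
have [/andP[/eqP ? /eqP ?]|not_id] := boolP ((c 0%N == 0) && (c 2%N == 0)).
  by right.
have dbl (x : F) : x + x = 0 by exact: addrr_pchar2.
(* [f s] solves [shift [:: s; t] c 0 = 0] for [t]; [D] omits its pole and [X] contains its fixed
   points. *)
pose f s := (c 2%N - s * c 1%N) / (c 1%N - s * c 0%N).
pose D : {set F} := [set s | c 1%N - s * c 0%N != 0].
have card_nD : (#|~: D| <= 1)%N.
  apply/card_le1_eqP => s t; rewrite !inE !negbK !subr_eq0 => /eqP es /eqP et.
  apply/eqP/negPn/negP => st; case/negP: nondeg.
  have [c0|c0] := eqVneq (c 0%N) 0; first by rewrite es c0 mulr0 expr0n mul0r.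
  by case/negP: st; apply/eqP/(mulIf c0); rewrite -es et.
pose X : {set F} := [set s | c 0%N * s ^+ 2 == c 2%N].
have card_X : (#|X| <= 1)%N.
  apply/card_le1_eqP => s t; rewrite !inE => /eqP es /eqP et.
  have c0 : c 0%N != 0.
    by apply: contra not_id => /eqP c0; rewrite c0 -es c0 mul0r eqxx.
  have /eqP : t ^+ 2 = s ^+ 2 by apply: (mulfI c0); rewrite es et.
  by rewrite eqf_sqr (oppr_pchar2 F2) orbb => /eqP ->.
pose Y : {set F} := [set s in D | f s \in W].
have f_inj : {in D &, injective f}.
  move=> s t; rewrite !inE => Ds Dt /eqP.
  rewrite /f (can2_eq (divfK Ds) (mulfK Ds)) mulrAC eq_sym.
  rewrite (can2_eq (divfK Dt) (mulfK Dt)) -subr_eq0.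
  have -> : (c 2%N - t * c 1%N) * (c 1%N - s * c 0%N)
      - (c 2%N - s * c 1%N) * (c 1%N - t * c 0%N)
    = (t - s) * (c 0%N * c 2%N - c 1%N ^+ 2) by ring.
  rewrite mulf_eq0 !subr_eq0 => /orP[/eqP //|/eqP e].
  by rewrite -e eqxx in nondeg.
have card_Y : (#|Y| <= size W)%N.
  rewrite -(card_in_imset (f := f)); last first.
    by move=> s t; rewrite !inE => /andP[? _] /andP[? _]; apply: f_inj; rewrite inE.
  apply: leq_trans (card_size W); apply/subset_leq_card/subsetP => y.
  by case/imsetP => s; rewrite inE => /andP[_ ?] ->.
exfalso.
(* An uncovered [s] would contradict [nz] through the pair [s], [f s]. Hence
   [#|F| <= 2 * size W + 2], against [card_F]. *)
have cover : ~: [set s in W] \subset ~: D :|: X :|: Y.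
  apply/subsetP => s; rewrite in_setC inE => sW; rewrite !inE.
  have [//|Ds] /= := eqVneq; have [|fsW] := boolP (f s \in W).
    by rewrite orbT.
  rewrite orbF; apply/negPn/negP => Xs.
  have fs_mul : f s * (c 1%N - s * c 0%N) = c 2%N - s * c 1%N by rewrite divfK.
  have fs : f s != s.
    apply: contra Xs => /eqP fs; rewrite fs in fs_mul.
    rewrite -subr_eq0; apply/eqP.
    transitivity ((s * c 1%N + s * c 1%N) - (c 2%N + c 2%N)
        - (s * (c 1%N - s * c 0%N) - (c 2%N - s * c 1%N))); first by ring.
    by rewrite fs_mul !dbl !subrr.
  have := nz [:: s; f s]; rewrite /= !inE (negPf sW) fsW W_uniq (eq_sym s) (negPf fs).
  move=> /(_ isT erefl)/eqP; apply.
  by rewrite /shift /= /shift1 fs_mul subrr.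
have : (#|F| <= size W + (1 + 1 + size W))%N.
  apply: leq_trans (card_setC_seq W) _; rewrite leq_add2l.
  apply: leq_trans (subset_leq_card cover) _.
  apply: leq_trans (leq_card_setU _ _) (leq_add _ card_Y).
  exact: leq_trans (leq_card_setU _ _) (leq_add card_nD card_X).
by move/(leq_trans card_F); lia.
Qed.

(** If two points [r] satisfy the second alternative of [hankel_pair] for [shift1 r b], then
    [b 0, ..., b 3] vanish; otherwise at least three points outside [W] remain for the lift. *)
Lemma hankel_triple (F : finFieldType) (W : seq F) (b : nat -> F) :
    2%N \in [pchar F] -> (2 * (size W + 3) <= #|F|)%N -> uniq W ->
    (forall V, uniq (V ++ W) -> size V = 3%N -> shift V b 0%N != 0) ->
  hankel_rank1 3 b.
Proof.
move=> F2 card_F W_uniq nz.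
have pair r : r \notin W -> let c := shift1 r b in
    c 1%N ^+ 2 = c 0%N * c 2%N \/ c 0%N = 0 /\ c 2%N = 0.
  move=> rW; apply: (@hankel_pair F (r :: W)) => //=.
      by apply: leq_trans card_F; lia.
    by rewrite rW.
  move=> V VrW V2; apply: (nz (r :: V)); last by rewrite /= V2.
  by rewrite -cat1s -catA uniq_catCA.
pose A : {set F} := [set r | (shift1 r b 0%N == 0) && (shift1 r b 2%N == 0)].
have [/card_gt1P[r [s [+ + rs]]]|card_A] := ltnP 1 #|A|.
  rewrite !inE /shift1 !subr_eq0 => /andP[/eqP r1 /eqP r3] /andP[/eqP s1 /eqP s3].
  have drs : r - s != 0 by rewrite subr_eq0.
  have b0 : b 0%N = 0.
    by apply: (mulfI drs); rewrite mulr0 mulrBl -r1 -s1 subrr.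
  have b2 : b 2%N = 0.
    by apply: (mulfI drs); rewrite mulr0 mulrBl -r3 -s3 subrr.
  have b1 : b 1%N = 0 by rewrite r1 b0 mulr0.
  have b3 : b 3%N = 0 by rewrite r3 b2 mulr0.
  by move=> [|[|[|//]]] [|[|[|//]]] _ _; rewrite ?b0 ?b1 ?b2 ?b3 ?mulr0 ?mul0r.
have /card_gt2P[x [y [z [[+ + +] [xy yz zx]]]]] : (2 < #|~: ([set s in W] :|: A)|)%N.
  have : (#|F| <= size W + (#|A| + #|~: ([set s in W] :|: A)|))%N.
    apply: leq_trans (card_setC_seq W) _; rewrite leq_add2l.
    apply: leq_trans (leq_card_setU _ _); apply/subset_leq_card/subsetP => r.
    by rewrite !inE negb_or; case: (r \in W) => //= _; rewrite orbN.
  by move/(leq_trans card_F); lia.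
have good r : r \in ~: ([set s in W] :|: A) -> hankel_rank1 2 (shift1 r b).
  rewrite !inE negb_or => /andP[rW rA]; apply: hankel_rank1_2.
  have [//|[r0 r2]] := pair r rW.
  by rewrite r0 r2 eqxx in rA.
by move=> /good Hx /good Hy /good Hz; apply: (hankel_rank1_lift _ xy yz zx).
Qed.

(** Moving a point [r] into [W] replaces [b] by [shift1 r b] and lowers [w] while [size W + w] stays
    fixed; three such points feed the lift. *)
Lemma hankel_rank1_nonvanishing (F : finFieldType) (w : nat) (W : seq F)
    (b : nat -> F) :
    2%N \in [pchar F] -> (2 * (size W + w + 3) <= #|F|)%N -> uniq W ->
    (forall V, uniq (V ++ W) -> size V = (w + 3)%N -> shift V b 0%N != 0) ->
  hankel_rank1 (w + 3) b.
Proof.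
move=> F2; elim: w W b => [|w IHw] W b card_F W_uniq nz.
  by apply: (@hankel_triple F W) => //; rewrite addn0 in card_F.
have good r : r \in ~: [set s in W] -> hankel_rank1 (w + 3) (shift1 r b).
  rewrite !inE => rW; apply: (IHw (r :: W)) => /=.
      by apply: leq_trans card_F; lia.
    by rewrite rW.
  move=> V VrW V_size; apply: (nz (r :: V)); last by rewrite /= V_size.
  by rewrite -cat1s -catA uniq_catCA.
have /card_gt2P[x [y [z [[Hx Hy Hz] [xy yz zx]]]]] : (2 < #|~: [set s in W]|)%N.
  rewrite -(ltn_add2l (size W)); apply: leq_trans (card_setC_seq W).
  by apply: leq_trans card_F; lia.
rewrite addSn; apply: (hankel_rank1_lift _ xy yz zx); by [lia | exact: good].
Qed.

(** * Existence of a point set killed by the functional *)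

Lemma shift_eq0 (R : nzRingType) (s : seq R) (b : nat -> R) :
  (forall i, (i <= size s)%N -> b i = 0) -> shift s b 0%N = 0.
Proof.
elim: s b => [|r s IHs] b b0 /=; first exact: b0.
apply: IHs => i lt_i.
by rewrite /shift1 !b0 //= ?mulr0 ?subr0 //; apply: leqW.
Qed.

Lemma exists_shift_eq0 (F : finFieldType) (n l : nat) (b : nat -> F) :
    2%N \in [pchar F] -> (2 < n)%N -> (2 * n <= #|F|)%N -> (l < n)%N ->
    b l != 0 -> (forall i, (i < l)%N -> b i = 0) ->
  exists T : seq F, [/\ uniq T, size T = n & shift T b 0%N = 0].
Proof.
move=> F2 n_gt2 card_F lt_ln bl b_lt.
pose P (T : n.-tuple F) := uniq T && (shift T b 0%N == 0).
have [/existsP[T /andP[T_uniq /eqP T0]]|none] := boolP [exists T, P T].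
  by exists T; rewrite size_tuple.
exfalso.
have rank1 : hankel_rank1 n b.
  have -> : n = (n - 3 + 3)%N by rewrite subnK.
  apply: (@hankel_rank1_nonvanishing F _ [::]) => //=.
    by apply: leq_trans card_F; lia.
  move=> V; rewrite cats0 subnK // => V_uniq V_size.
  have /existsPn/(_ (Tuple (introT eqP V_size))) := none.
  by rewrite /P /= V_uniq.
(* If the first nonzero index is positive, a minor equates the square of that entry with 0. *)
case: l lt_ln bl b_lt => [n_gt0|l lt_ln] bl b_lt; last first.
  have := rank1 l l.+1 (ltnW lt_ln) lt_ln.
  rewrite b_lt // mul0r => /esym/eqP.
  by rewrite mulf_eq0 (negPf bl).
(* Now [b] is geometric of ratio [r] up to index [n]: L is a multiple of evaluation at [r], and any
   [T] containing [r] works. *)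
pose r := b 1%N / b 0%N.
have geom i : (i < n)%N -> shift1 r b i = 0.
  move=> lt_i; apply: (mulfI bl); rewrite mulr0 /shift1 mulrBr rank1 //.
  by rewrite /r mulrA (mulrC (b 0%N)) divfK // subrr.
have [s [s_uniq s_size rs]] : exists s, [/\ uniq s, size s = n.-1 & r \notin s].
  exists (take n.-1 (enum (predC1 r))); split; first by rewrite take_uniq ?enum_uniq.
    by rewrite size_takel // -cardE cardC1; case: #|F| card_F => [|N] /=; lia.
  by apply/negP => /mem_take; rewrite mem_enum !inE eqxx.
have size_rs : size (r :: s) = n by rewrite /= s_size; lia.
have /existsPn/(_ (Tuple (introT eqP size_rs))) := none.
have rs0 : shift (r :: s) b 0%N = 0.
  by apply: (@shift_eq0 _ s) => i; rewrite s_size => le_i; apply: geom; lia.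
by rewrite /P rs0 eqxx /= rs s_uniq.
Qed.

(** * Complete symmetric values and complements in the field *)

(** The values h_e at the entries of [s]; the recursion sorts monomials by whether they contain the
    first variable. *)
Fixpoint hseq (R : nzRingType) (s : seq R) : nat -> R :=
  if s is x :: s' then
    fix hx e := if e is e'.+1 then hseq s' e + x * hx e' else 1
  else fun e => (e == 0%N)%:R.

Arguments hseq : simpl never.

Lemma hseq0 (R : nzRingType) (s : seq R) : hseq s 0 = 1.
Proof. by case: s. Qed.

Lemma hseq_consS (R : nzRingType) (x : R) (s : seq R) (e : nat) :
  hseq (x :: s) e.+1 = hseq s e.+1 + x * hseq (x :: s) e.
Proof. by []. Qed.

Lemma coef_mulXsubC (R : comNzRingType) (r : R) (p : {poly R}) (i : nat) :
  (('X - r%:P) * p)`_i = (if i is j.+1 then p`_j else 0) - r * p`_i.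
Proof. by rewrite mulrBl coefB coefXM coefCM; case: i. Qed.

(** Summation by parts moves each factor X - r from the polynomial to the sequence. *)
Lemma shift_coefE (R : comNzRingType) (T : seq R) (b : nat -> R) :
  shift T b 0%N = \sum_(i < (size T).+1) b i * (\prod_(t <- T) ('X - t%:P))`_i.
Proof.
elim: T b => [|r T IHT] b.
  by rewrite /= big_ord_recl big_ord0 big_nil coef1 mulr1 addr0.
have -> : shift (r :: T) b = shift T (shift1 r b) by [].
rewrite IHT big_cons; set g := \prod_(t <- T) _.
under [RHS]eq_bigr do rewrite coef_mulXsubC mulrBr.
rewrite sumrB [X in _ = X - _]big_ord_recl /= mulr0 add0r.
rewrite [X in _ - X]big_ord_recr /= [g`_(size T).+1]nth_default; last first.
  by rewrite size_prod_XsubC.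
rewrite !mulr0 addr0 -sumrB; apply: eq_bigr => i _.
by rewrite /bump /= add1n /shift1 mulrBl mulrCA mulrA.
Qed.

(** Division form of the generating function: the h_e are the coefficients of the product of the
    1/(1 - x z). *)
Lemma hseq_quotient (R : comNzRingType) (s : seq R) (M : nat) :
  exists2 r : {poly R}, (size r <= size s)%N &
    'X^(M + size s)
      = \prod_(x <- s) ('X - x%:P) * \poly_(i < M.+1) hseq s (M - i) + r.
Proof.
elim: s => [|x s [r r_size IHs]].
  exists 0; first by rewrite size_poly0.
  rewrite addn0 addr0 big_nil mul1r; apply/polyP => i.
  rewrite coefXn coef_poly /hseq ltnS subn_eq0.
  by case: ltngtP.
set g := \prod_(y <- s) _ in IHs *.
(* Dividing ['X] times the old quotient by X - x leaves the constant [x * hseq (x :: s) M], whose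
   product with [g] joins the remainder. *)
exists ('X * r + (x * hseq (x :: s) M)%:P * g).
  rewrite (leq_trans (size_polyD _ _)) // geq_max /=; apply/andP; split.
    by rewrite (leq_trans (size_polyMleq _ _)) // size_polyX.
  rewrite mul_polyC (leq_trans (size_scale_leq _ _)) //.
  by rewrite size_prod_XsubC.
have quot : ('X - x%:P) * \poly_(i < M.+1) hseq (x :: s) (M - i)
    = 'X * \poly_(i < M.+1) hseq s (M - i) - (x * hseq (x :: s) M)%:P.
  apply/polyP => -[|i]; rewrite coef_mulXsubC coefB coefXM coefC /= !coef_poly.
    by rewrite subn0.
  rewrite subr0 !ltnS; case: ltngtP => [lt_iM|lt_Mi|->].
  - by rewrite -(subnSK lt_iM) hseq_consS addrK.
  - by rewrite mulr0 subr0.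
  - by rewrite subnn !hseq0 mulr0 subr0.
rewrite big_cons -/g [_ * g]mulrC -[X in _ = X + _]mulrA quot.
by rewrite addnS exprS IHs; ring.
Qed.

(* Both sides are quotients: dividing X^q - X by prod_(x in S) (X - x) gives the
   product over T exactly, and dividing X^q gives the h_e(S) as coefficients. *)
Lemma hseq_complement (F : finFieldType) (n : nat) (s T : seq F) :
    #|F| = (n + n)%N -> (1 < n)%N -> size s = n -> size T = n ->
    perm_eq (s ++ T) (enum F) ->
  \prod_(t <- T) ('X - t%:P) = \poly_(i < n.+1) hseq s (n - i).
Proof.
move=> card_F n_gt1 s_size T_size sT.
have [r] := hseq_quotient s n; rewrite s_size -card_F => r_size quot.
set gs := \prod_(x <- s) _ in quot; set gT := \prod_(t <- T) _.
have gsT : gs * gT = 'X^#|F| - 'X.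
  by rewrite finField_genPoly -big_cat (perm_big _ sT) big_enum.
(* The difference times [gs] is [r - 'X], of size at most [n]; a nonzero difference would make that
   size exceed [n]. *)
apply/eqP; rewrite -subr_eq0; apply/negPn/negP => nz.
have : (n < size (gs * (gT - \poly_(i < n.+1) hseq s (n - i)))%R)%N.
  rewrite size_monicM ?monic_prod_XsubC // size_prod_XsubC s_size.
  by rewrite addSn -[X in (X < _)%N]addn0 ltn_add2l lt0n size_poly_eq0.
rewrite mulrBr gsT quot.
have -> : gs * (\poly_(i < n.+1) hseq s (n - i)) + r - 'X
    - gs * (\poly_(i < n.+1) hseq s (n - i)) = r - 'X by ring.
apply/negP; rewrite -leqNgt (leq_trans (size_polyD _ _)) //.
by rewrite geq_max r_size size_polyN size_polyX.
Qed.

Lemma exists_hseq_zero_set (F : finFieldType) (n m : nat) (a : nat -> F) :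
    2%N \in [pchar F] -> #|F| = (n + n)%N -> (2 < n)%N -> (0 < m <= n)%N ->
    a m != 0 ->
  exists2 S : {set F}, #|S| = n &
    forall s, uniq s -> s =i S -> \sum_(e < m.+1) a e * hseq s e = 0.
Proof.
move=> F2 card_F n_gt2 /andP[m_gt0 le_mn] am.
(* Reversed because h_e is the coefficient of X^(n-e), and 0 where n - i > m. The first nonzero
   index is n - m, below [n] since m > 0. *)
pose b i := if (n - m <= i)%N then a (n - i)%N else 0.
have [||||T [T_uniq T_size T0]] := @exists_shift_eq0 F n (n - m) b F2 n_gt2.
- by rewrite card_F; lia.
- by lia.
- by rewrite /b leqnn subKn.
- by move=> i; rewrite /b ltnNge => /negPf ->.
have C_card : #|~: [set t in T]| = n.
  have := cardsC [set t in T].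
  by rewrite cardsE (card_uniqP T_uniq) T_size card_F; lia.
exists (~: [set t in T]) => // s s_uniq sS.
have s_size : size s = n by rewrite -(card_uniqP s_uniq) (eq_card sS).
have sT : perm_eq (s ++ T) (enum F).
  apply: uniq_perm; [|exact: enum_uniq|].
    rewrite cat_uniq s_uniq T_uniq andbT; apply/hasPn => t tT.
    by rewrite sS !inE negbK.
  by move=> x; rewrite mem_cat sS !inE mem_enum; case: (x \in T).
have prodT := hseq_complement card_F (ltnW n_gt2) s_size T_size sT.
rewrite -[RHS]T0 shift_coefE prodT T_size.
rewrite (big_ord_widen n.+1 (fun e => a e * hseq s e)) // [LHS]big_mkcond /=.
rewrite [LHS](reindex_inj rev_ord_inj); apply: eq_bigr => i _.
rewrite coef_poly ltn_ord /b /= subSS !ltnS leq_subLR addnC -leq_subLR.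
by case: ifP; rewrite // mul0r.
Qed.

(** Fixing a variable only adds terms of lower degree, so the leading coefficient survives. *)
Lemma hseq_sum_cat (R : nzRingType) (m : nat) (a : nat -> R) (s : seq R) :
  exists2 a' : nat -> R, a' m = a m & forall s',
    \sum_(e < m.+1) a e * hseq (s ++ s') e = \sum_(e < m.+1) a' e * hseq s' e.
Proof.
have cons1 x : forall a, exists2 a' : nat -> R, a' m = a m & forall s',
    \sum_(e < m.+1) a e * hseq (x :: s') e = \sum_(e < m.+1) a' e * hseq s' e.
  elim: m {a} => [|m IHm] a.
    by exists a => // s'; rewrite !big_ord_recl !big_ord0 !hseq0.
  (* The degree-[m] coefficient absorbs the second term of [hseq_consS] at degree [m.+1]. *)
  have [a' _ a'E] := IHm (fun e => a e + (e == m)%:R * (a m.+1 * x)).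
  exists (fun e => if e == m.+1 then a m.+1 else a' e); first by rewrite eqxx.
  move=> s'; rewrite [LHS]big_ord_recr [RHS]big_ord_recr /= eqxx hseq_consS.
  rewrite mulrDr addrCA addrA [RHS]addrC -addrA; congr (_ + _).
  transitivity (\sum_(e < m.+1) a' e * hseq s' e); last first.
    by apply: eq_bigr => i _; rewrite ltn_eqF.
  rewrite -a'E !big_ord_recr /= eqxx mul1r mulrDl !mulrA addrA.
  congr (_ + _ + _); apply: eq_bigr => i _.
  by rewrite ltn_eqF // mul0r addr0.
elim: s a => [|x s IHs] a; first by exists a.
have [a1 a1m a1E] := cons1 x a; have [a2 a2m a2E] := IHs a1.
by exists a2 => [|s']; rewrite ?a2m // a1E a2E.
Qed.

(** * Evaluation of [hcsym] *)

(** The lower bound [j] allows induction: after a first entry [i], the rest is a path from [i]. *)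
Lemma sum_path_tuples (R : comNzRingType) (k : nat) (x : 'I_k -> R) (e j : nat) :
    (j <= k)%N ->
  \sum_(t : e.-tuple 'I_k | path leq j (map val t)) \prod_(i <- t) x i
    = hseq [seq x i | i <- drop j (enum 'I_k)] e.
Proof.
elim: e j => [|e IHe] j le_jk.
  rewrite hseq0 (big_pred1 [tuple]) ?big_nil // => t.
  by rewrite [t]tuple0 /= eqxx.
transitivity (\sum_(i < k | (j <= i)%N)
    x i * hseq [seq x l | l <- drop i (enum 'I_k)] e).
  under [RHS]eq_bigr => i _ do rewrite -(IHe i (ltnW (ltn_ord i))) big_distrr.
  rewrite pair_big_dep /=.
  rewrite (reindex (fun p : 'I_k * e.-tuple 'I_k => cons_tuple p.1 p.2)) /=.
    by apply: eq_bigr => -[i t] _ /=; rewrite big_cons.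
  exists (fun t : e.+1.-tuple 'I_k => (thead t, behead_tuple t)) => [[i t] _|t _].
    by congr (_, _); apply: val_inj.
  by rewrite [RHS]tuple_eta; apply: val_inj.
(* Downward induction on [j]: splitting off the term [i = j] matches [hseq_consS]. *)
rewrite -(subKn le_jk); elim: (k - j)%N (leq_subr j k) => [|l IHl] le_lk.
  rewrite subn0 drop_oversize ?size_enum_ord // big_pred0 // => i.
  by rewrite leqNgt ltn_ord.
have lt_k : (k - l.+1 < k)%N by lia.
set o := Ordinal lt_k.
have drop_o : drop (k - l.+1) (enum 'I_k) = o :: drop (k - l) (enum 'I_k).
  rewrite (drop_nth o) ?size_enum_ord // subnSK //; congr (_ :: _).
  by apply: val_inj; rewrite /= nth_enum_ord.
rewrite drop_o map_cons hseq_consS -(IHl (ltnW le_lk)).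
rewrite (bigD1 o) //= drop_o addrC.
congr (_ + _); apply: eq_bigl => i.
by rewrite -[LHS]andbC -val_eqE /= eq_sym -ltn_neqAle subnSK.
Qed.

Lemma meval_hcsym (R : comNzRingType) (k e : nat) (x : 'I_k -> R) :
  (hcsym k R e).@[x] = hseq [seq x i | i <- enum 'I_k] e.
Proof.
rewrite -[enum _]drop0 -sum_path_tuples // /hcsym raddf_sum /=.
apply: eq_big => [t|t _]; first by case: (map val t).
by rewrite rmorph_prod; apply: eq_bigr => i _; exact: mevalXU.
Qed.

(** * Splitting the coordinates and counting zeros *)

Definition join_ffun (A : Type) (d n : nat) (y : {ffun 'I_d -> A})
    (f : {ffun 'I_n -> A}) : {ffun 'I_(d + n) -> A} :=
  [ffun i => match split i with inl j => y j | inr j => f j end].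

Lemma join_ffun_inj (A : Type) (d n : nat) (y y' : {ffun 'I_d -> A})
    (f f' : {ffun 'I_n -> A}) :
  join_ffun y f = join_ffun y' f' -> (y, f) = (y', f').
Proof.
move=> /ffunP yf; congr (_, _); apply/ffunP => i.
  by have := yf (unsplit (inl i)); rewrite !ffunE unsplitK.
by have := yf (unsplit (inr i)); rewrite !ffunE unsplitK.
Qed.

Lemma map_join_ffun (A : Type) (d n : nat) (y : {ffun 'I_d -> A})
    (f : {ffun 'I_n -> A}) :
  [seq join_ffun y f i | i <- enum 'I_(d + n)]
    = [seq y i | i <- enum 'I_d] ++ [seq f i | i <- enum 'I_n].
Proof.
have -> : enum 'I_(d + n)
    = map (@lshift d n) (enum 'I_d) ++ map (@rshift d n) (enum 'I_n).
  apply: (inj_map val_inj); rewrite val_enum_ord iotaD add0n map_cat.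
  rewrite -(map_comp val (@lshift d n)) -(map_comp val (@rshift d n)).
  congr (_ ++ _); first by rewrite -val_enum_ord; apply: eq_map.
  rewrite -[X in iota X]addn0 iotaDl -val_enum_ord -(map_comp (addn d)).
  exact: eq_map.
rewrite map_cat -(map_comp _ (@lshift d n)) -(map_comp _ (@rshift d n)).
congr (_ ++ _); apply: eq_map => i /=.
  by rewrite ffunE (unsplitK (inl i)).
by rewrite ffunE (unsplitK (inr i)).
Qed.

Local Close Scope ring_scope.

Theorem theorem1p8 (F : finFieldType) (q k m : nat) (h : {mpoly F[k]})
    (Fq : #|F| = q) (q_pow2 : exists n : nat, q = 2 ^ n) (q_ge8 : 8 <= q)
    (k_ge : q./2 <= k) (m_ge1 : 1 <= m) (m_le : m <= q./2)
    (h_csym : is_csym m h) :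
  (q./2)`! * q ^ (k - q./2) <= zero_count h.
Proof.
have [c q_c] := q_pow2.
have F2 : 2 \in [pchar F]%R by apply: (@card_finPcharP _ _ c); rewrite ?Fq.
set n := q./2 in k_ge m_le *.
have qE : q = n + n.
  case: c q_c => [|c] q_c; first by rewrite q_c in q_ge8.
  by rewrite /n q_c expnS mul2n doubleK addnn.
have [d kE] : exists d, k = d + n by exists (k - n); rewrite subnK.
subst k; rewrite addnK.
have [a [am hE]] := h_csym.
(* The set depends on the fixed coordinates [y]; an injective [f] into it lists it in some order,
   which leaves the symmetric value unchanged. *)
have S_ex (y : {ffun 'I_d -> F}) : exists2 S : {set F}, #|S| = n &
    forall f : {ffun 'I_n -> F}, injective f -> (forall i, f i \in S) ->
      (h.@[join_ffun y f] = 0)%R.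
  have [a' a'm a'E] := hseq_sum_cat m a [seq y i | i <- enum 'I_d].
  have [| | | |S S_card S_zero] := @exists_hseq_zero_set F n m a' F2.
  - by rewrite Fq.
  - by lia.
  - by rewrite m_ge1.
  - by rewrite a'm.
  exists S => // f f_inj fS.
  rewrite hE raddf_sum /=.
  under eq_bigr do rewrite mevalZ meval_hcsym map_join_ffun.
  rewrite a'E; apply: S_zero; first by rewrite map_inj_uniq ?enum_uniq.
  have sub : {subset [seq f i | i <- enum 'I_n] <= enum S}.
    by move=> _ /mapP[i _ ->]; rewrite mem_enum.
  have f_uniq : uniq [seq f i | i <- enum 'I_n] by rewrite map_inj_uniq ?enum_uniq.
  have [|_ eqS] := uniq_min_size f_uniq sub.
    by rewrite size_map size_enum_ord -cardE S_card.
  by move=> z; rewrite eqS mem_enum.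
have [S S_card S_zero] := fin_all_exists2 S_ex.
pose G y := [set f : {ffun 'I_n -> F} in ffun_on (mem (S y)) | injectiveb f].
(* There are [q ^ d] choices of [y] and n! bijections onto [S y] for each; [join_ffun] embeds these
   pairs into the zeros. *)
pose P := [set p : {ffun 'I_d -> F} * {ffun 'I_n -> F} | p.2 \in G p.1].
have P_card : #|P| = n`! * q ^ d.
  rewrite -sum1_card (eq_bigl (fun p => predT p.1 && (p.2 \in G p.1))); last first.
    by move=> p; rewrite inE.
  rewrite -(pair_big_dep predT (fun y f => f \in G y) (fun _ _ => 1)) /=.
  under eq_bigr => y _ do rewrite sum1_card card_inj_ffuns_on card_ord S_card ffactnn.
  by rewrite sum_nat_const card_ffun card_ord Fq mulnC.
rewrite -P_card /zero_count -(card_in_imset (f := fun p => join_ffun p.1 p.2)); last first.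
  by move=> [y f] [y' f'] _ _ /join_ffun_inj.
apply/subset_leq_card/subsetP => _ /imsetP[[y f] + ->].
rewrite !inE /= => /andP[/ffun_onP fS /injectiveP f_inj].
by apply/eqP/S_zero.
Qed.
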